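(* Let $d\ge 2$ be an integer. For every positive integer $N$, $$\rho_d(N)\le \sum_{k=1}^{d-1}\pi\left(\frac{N}{k}\right)+D\left(\mathbb{Z}_d^{\pi(N/d)}\right)-(d-1)\pi\left(\frac{N}{d}\right)-1,$$ where $\pi(x)$ denotes the number of primes not exceeding $x$.
   Context: For positive integers $d$ and $N$, $\rho_d(N)$ denotes the maximum size of a set $A\subseteq\{1,2,\dots,N\}$ such that there are no $\ell\ge 1$, pairwise distinct $a_1,\dots,a_\ell\in A$ and integer $x$ with $a_1a_2\cdots a_\ell=x^d$. For a finite abelian group $G$, the Davenport constant $D(G)$ is the smallest positive integer $\ell$ such that every sequence of $\ell$ elements of $G$ (repetitions allowed) contains a non-empty subsequence whose sum is $0$. $\mathbb{Z}_d^m$ denotes the direct sum of $m$ copies of the cyclic group $\mathbb{Z}/d\mathbb{Z}$. *)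

(* Defs.v *)
From mathcomp Require Import all_boot all_order all_algebra.
From mathcomp Require Import boolp.

Set Implicit Arguments.
Unset Strict Implicit.
Unset Printing Implicit Defensive.

Import Order.TTheory GRing.Theory Num.Theory.
Local Open Scope ring_scope.

(* For x >= 0, [Num.truncn x] is the integer part of x, so the range misses no
   prime p <= x. *)
Definition primepi (x : rat) : nat :=
  count (fun p : nat => prime p && (p%:R <= x)) (iota 0 (Num.truncn x).+1).

Definition power_product_free (d : nat) (A : pred nat) : Prop :=
  ~ exists (s : seq nat) (x : int),
      [/\ s != [::], uniq s, {subset s <= A} &
          \prod_(a <- s) a%:Z = x ^+ d].

(* Subsets of {1, ..., N} are encoded as subsets of {0, ..., N} avoiding 0. *)
Definition rho (d N : nat) : nat :=
  (\max_(A : {set 'I_N.+1} | (ord0 \notin A) &&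
      `[< power_product_free d (mem [seq val i | i in A]) >]) #|A|)%N.

Definition has_zero_sum_subseq (G : zmodType) (s : seq G) : Prop :=
  exists t : seq G, [/\ t != [::], subseq t s & \sum_(g <- t) g = 0].

Definition davenport_bound (G : finZmodType) (l : nat) : Prop :=
  (0 < l)%N /\ forall s : seq G, size s = l -> has_zero_sum_subseq s.

(* Among the #|G| + 1 partial sums of s, two coincide. *)
Lemma davenport_bound_card (G : finZmodType) : davenport_bound G #|G|.
Proof.
split; first by apply/card_gt0P; exists 0.
move=> s sz_s; pose f (i : 'I_#|G|.+1) := \sum_(g <- take i s) g.
have /injectivePn[i [j neq_ij eq_f]] : ~~ injectiveb f.
  apply/injectiveP => /leq_card; rewrite card_ord.
  by rewrite ltnn.
wlog lt_ij : i j neq_ij eq_f / (i < j)%N => [IH|].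
  case: (ltngtP i j) => [/IH|/IH|/val_inj eq_ij]; [exact | | ].
    by apply; rewrite // eq_sym.
  by rewrite eq_ij eqxx in neq_ij.
have le_j : (j <= size s)%N by rewrite sz_s -ltnS.
exists (drop i (take j s)); split.
- by rewrite -size_eq0 size_drop size_takel // subn_eq0 -ltnNge.
- exact: subseq_trans (drop_subseq _ _) (take_subseq _ _).
have : f j = f i + \sum_(g <- drop i (take j s)) g.
  by rewrite /f -[in LHS](cat_take_drop i (take j s)) big_cat /= -take_min (minn_idPl (ltnW lt_ij)).
by rewrite eq_f -[LHS]addr0 => /addrI.
Qed.

Fact davenport_exists (G : finZmodType) :
  exists l : nat, `[< davenport_bound G l >].
Proof. by exists #|G|; apply/asboolP; exact: davenport_bound_card. Qed.

Definition davenport (G : finZmodType) : nat :=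
  ex_minn (davenport_exists G).

(* Main.v *)
(** A prime p <= N occurs in the sum of the pi(N/k), 1 <= k < d, exactly
    min(d - 1, floor(N/p)) times.  Subtracting (d - 1) pi(N/d) leaves
    floor(N/p) for each prime p > N/d, which bounds the number of elements of
    A divisible by p.  The remaining elements of A have all their prime
    factors at most N/d, so their exponent vectors modulo d form a sequence in
    Z_d^pi(N/d) without non-empty zero-sum subsequence. *)

Require Import Defs.
From mathcomp Require Import all_boot all_order all_algebra.
From mathcomp Require Import boolp zify.

Import Order.TTheory GRing.Theory Num.Theory.
Local Open Scope ring_scope.

(** Clearing the denominator removes the rationals, and for every [k] the range is enlarged to the
    same [iota 0 N.+1], which later permits exchanging sums over [k] and [p]. The added integers
    exceed N/k, so they contribute nothing. *)
Lemma primepi_divE (N k : nat) : (0 < k)%N ->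
  primepi (N%:R / k%:R) = size [seq p <- iota 0 N.+1 | prime p & (p * k <= N)%N].
Proof.
move=> k0; rewrite /primepi size_filter.
have le_divE (p : nat) : ((p%:R : rat) <= N%:R / k%:R) = (p * k <= N)%N.
  by rewrite ler_pdivlMr ?ltr0n // -natrM ler_nat.
have q0 : 0 <= N%:R / k%:R :> rat by rewrite divr_ge0 ?ler0n.
set t := Num.truncn _.
have t_le (p : nat) : (p * k <= N)%N = (p <= t)%N.
  by rewrite -le_divE -truncn_ge_nat.
rewrite (eq_count (a2 := fun p => prime p && (p * k <= N)%N)); last first.
  by move=> p /=; rewrite le_divE.
have tN : (t.+1 <= N.+1)%N by rewrite ltnS (leq_trans (leq_pmulr t k0)) // t_le.
rewrite -(subnKC tN) iotaD count_cat add0n.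
rewrite [X in (_ + X)%N](_ : _ = 0%N) ?addn0 //.
apply/eqP; rewrite -leqn0 leqNgt -has_count; apply/hasPn => p.
by rewrite mem_iota => /andP[tp _]; rewrite negb_and t_le -ltnNge tp orbT.
Qed.

Lemma exp_of_dvdn_logn (d n : nat) : (0 < n)%N ->
  (forall p, prime p -> (d %| logn p n)%N) -> exists x, n = (x ^ d)%N.
Proof.
move=> n0 dvd_log.
exists (\prod_(p <- primes n) p ^ (logn p n %/ d))%N.
rewrite {1}(prod_prime_decomp n0) prime_decompE big_map /=.
rewrite (big_morph (expn^~ d) (fun a b => expnMn a b d) (exp1n d)).
apply: eq_big_seq => p; rewrite mem_primes => /andP[pp _].
by rewrite -expnM divnK // dvd_log.
Qed.

Lemma logn_prod (I : eqType) (p : nat) (s : seq I) (F : I -> nat) :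
  (forall i, i \in s -> 0 < F i)%N ->
  logn p (\prod_(i <- s) F i) = (\sum_(i <- s) logn p (F i))%N.
Proof.
elim: s => [|i s IHs] Fpos; first by rewrite !big_nil logn1.
have Fs j : j \in s -> (0 < F j)%N by move=> js; rewrite Fpos // inE js orbT.
rewrite !big_cons lognM ?IHs ?Fpos ?mem_head //.
by rewrite big_seq_cond prodn_cond_gt0 // => j /andP[/Fs].
Qed.

(** [davenport_bound] speaks of sequences of one exact length, so a longer sequence is first
    truncated to that length. *)
Lemma davenport_gt_size (G : finZmodType) (s : seq G) :
  ~ has_zero_sum_subseq s -> (size s < davenport G)%N.
Proof.
move=> nzs; rewrite ltnNge; apply/negP => Ds; apply: nzs.
move: Ds; rewrite /davenport; case: ex_minnP => l /asboolP[_ dl] _ ls.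
have [t [t0 tl tsum]] := dl (take l s) (size_takel ls).
by exists t; split=> //; exact: subseq_trans tl (take_subseq _ _).
Qed.

(** For [d <= 1] the type ['Z_d] is Z/2, hence the assumption on [d]. *)
Lemma natr_Zp_eq0 (d n : nat) : (1 < d)%N -> ((n%:R : 'Z_d) == 0) = (d %| n)%N.
Proof. by move=> d1; rewrite -val_eqE /= val_Zp_nat. Qed.

Section SmoothPart.

Variables (d : nat) (r s : seq nat).
Hypotheses (d1 : (1 < d)%N) (uniq_s : uniq s).
Hypothesis s_gt0 : forall a : nat, a \in s -> (0 < a)%N.
Hypothesis s_smooth :
  forall a p : nat, a \in s -> prime p -> (p %| a)%N -> p \in r.
Hypothesis s_free : power_product_free d (mem s).

Lemma size_power_product_free_smooth :
  (size s < davenport 'rV['Z_d]_(size r))%N.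
Proof.
pose v (a : nat) : 'rV['Z_d]_(size r) := \row_j (logn (nth 0%N r j) a)%:R.
rewrite -(size_map v); apply: davenport_gt_size => -[t [t0 /subseqP[b _]]].
(* Distinct integers may share an exponent vector. Lifting the zero-sum subsequence to a mask of [s]
   keeps the chosen integers pairwise distinct. *)
rewrite -map_mask; set u := mask b s => tE; rewrite {}tE in t0 *.
have us : {subset u <= s} by move=> a; exact: mem_mask.
have u_gt0 a : a \in u -> (0 < a)%N by move/us/s_gt0.
rewrite big_map => /rowP vsum0.
have [||x prodE] := @exp_of_dvdn_logn d (\prod_(a <- u) a).
- by rewrite big_seq_cond prodn_cond_gt0 // => a /andP[/u_gt0].
- move=> p pp; rewrite logn_prod //.
  have [pr|pNr] := boolP (p \in r).
    rewrite -natr_Zp_eq0 // natr_sum; apply/eqP.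
    have pir : (index p r < size r)%N by rewrite index_mem.
    have := vsum0 (Ordinal pir); rewrite summxE mxE => vj0; rewrite -[RHS]vj0.
    by apply: eq_bigr => a _; rewrite mxE /= nth_index.
  (* A prime outside [r] divides no element of [s], so its exponent in the product is 0. *)
  rewrite big_seq big1 // => a /us sa; apply/eqP.
  rewrite -leqn0 leqNgt logn_gt0 mem_primes pp s_gt0 //=.
  by apply: contra pNr; exact: s_smooth.
apply: s_free; exists u, x%:Z; split=> //.
- by move: t0; rewrite -!size_eq0 size_map.
- exact: mask_uniq.
- by rewrite -natz -natrX -prodE natr_prod; apply: eq_bigr => a _; rewrite natz.
Qed.

End SmoothPart.

(** The map sending [a] to [a %/ p] is injective on multiples of [p]. Its values on [A] are
    positive, as 0 is excluded, and below [d], as [N < p * d]. *)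
Lemma card_multiples_le (N d p : nat) (A : {set 'I_N.+1}) :
  ord0 \notin A -> (N < p * d)%N ->
  (#|[set a in A | (p %| a)%N]| <= \sum_(1 <= k < d) (p * k <= N))%N.
Proof.
move=> A0 Npd; have p0 : (0 < p)%N by case: p Npd.
have -> : (\sum_(1 <= k < d) (p * k <= N) =
           size [seq k <- index_iota 1 d | p * k <= N])%N.
  by rewrite size_filter -sum1_count [RHS]big_mkcond.
rewrite cardE -(size_map (fun a : 'I_N.+1 => a %/ p)%N).
apply: uniq_leq_size.
  rewrite map_inj_in_uniq ?enum_uniq // => a b.
  rewrite !mem_enum !inE => /andP[_ pa] /andP[_ pb] eq_ab; apply: val_inj.
  by rewrite /= -(divnK pa) eq_ab divnK.
move=> k /mapP[a]; rewrite mem_enum inE => /andP[aA pa] ->.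
have a0 : (0 < a)%N.
  rewrite lt0n; apply: contraNneq A0 => a0.
  by rewrite (_ : ord0 = a) //; apply: val_inj.
rewrite mem_filter mem_index_iota mulnC divnK // -ltnS ltn_ord /=.
rewrite divn_gt0 // (dvdn_leq a0 pa) ltn_divLR // mulnC.
by rewrite (leq_ltn_trans _ Npd) // -ltnS.
Qed.

Lemma sum_primepi_divE (N d : nat) :
  (\sum_(1 <= k < d) primepi (N%:R / k%:R) =
   \sum_(p < N.+1 | prime p) \sum_(1 <= k < d) (p * k <= N))%N.
Proof.
rewrite exchange_big; apply: eq_big_nat => k /andP[k0 _].
rewrite primepi_divE // size_filter -sum1_count.
rewrite -[iota 0 N.+1]/(index_iota 0 N.+1) big_mkord big_mkcondr.
by apply: eq_bigr => p _; case: leqP.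
Qed.

Lemma card_power_product_free (d N : nat) (A : {set 'I_N.+1}) :
    (1 < d)%N -> ord0 \notin A ->
    power_product_free d (mem [seq val i | i in A]) ->
  (#|A| + d.-1 * primepi (N%:R / d%:R) <
   \sum_(1 <= k < d) primepi (N%:R / k%:R)
   + davenport 'rV['Z_d]_(primepi (N%:R / d%:R)))%N.
Proof.
move=> d1 A0 Afree; have d0 := ltnW d1.
set m := primepi (N%:R / d%:R).
pose r := [seq p <- iota 0 N.+1 | prime p & (p * d <= N)%N].
have mE : m = size r by rewrite /m primepi_divE.
pose large (p : 'I_N.+1) := prime p && (N < p * d)%N.
(* An element may have several large prime factors; the union bound in [cardB] tolerates this
   overcounting. *)
pose B := \bigcup_(p | large p) [set a in A | (p %| a)%N].
have cardB : (#|B| <= \sum_(p | large p) \sum_(1 <= k < d) (p * k <= N))%N.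
  apply: (@leq_trans (\sum_(p | large p) #|[set a in A | (p %| a)%N]|)).
    rewrite /B; elim/big_rec2: _ => [|p n C _ le_C]; first by rewrite cards0.
    by rewrite (leq_trans (leq_card_setU _ _)) ?leq_add2l.
  by apply: leq_sum => p /andP[_ Npd]; exact: card_multiples_le.
have A_gt0 (a : 'I_N.+1) : a \in A -> (0 < a)%N.
  move=> aA; rewrite lt0n; apply: contraNneq A0 => a0.
  by rewrite (_ : ord0 = a) //; apply: val_inj.
have cardAB : (#|A :\: B| < davenport 'rV['Z_d]_m)%N.
  rewrite mE cardE -(size_map val).
  apply: size_power_product_free_smooth => //.
  - by rewrite map_inj_uniq ?enum_uniq //; exact: val_inj.
  - move=> _ /mapP[a + ->]; rewrite mem_enum inE => /andP[_]; exact: A_gt0.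
  - move=> _ p /mapP[a + ->] pp /= pa; rewrite mem_enum inE => /andP[aB aA].
    have pN : (p < N.+1)%N.
      by rewrite (leq_ltn_trans (dvdn_leq (A_gt0 _ aA) pa)).
    rewrite mem_filter pp mem_iota pN leq0n !andbT /= leqNgt.
    apply: contra aB => Npd; apply/bigcupP; exists (Ordinal pN).
      by rewrite /large pp.
    by rewrite inE aA.
  - move=> [s [x [s0 us sA sx]]]; apply: Afree; exists s, x; split=> //.
    move=> y /sA /mapP[a + ->]; rewrite mem_enum inE => /andP[_ aA].
    exact: image_f.
(* If [p * d <= N], then all [d.-1] indices [k] satisfy [p * k <= N], so each of the [m] small
   primes is counted [d.-1] times. *)
have small : (\sum_(p < N.+1 | prime p && (p * d <= N)%N)
                \sum_(1 <= k < d) (p * k <= N) = d.-1 * m)%N.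
  rewrite mE size_filter -sum1_count -[iota 0 N.+1]/(index_iota 0 N.+1) big_mkord.
  rewrite big_distrr /=; apply: eq_bigr => p /andP[_ pdN].
  rewrite muln1 -subn1 -[RHS]muln1 -sum_nat_const_nat; apply: eq_big_nat => k.
  move=> /andP[_ kd]; rewrite (leq_trans _ pdN) //.
  by rewrite leq_mul2l (ltnW kd) orbT.
rewrite sum_primepi_divE (bigID (fun p : 'I_N.+1 => p * d <= N)%N) /= small.
rewrite (eq_bigl large); last by move=> p; rewrite /large ltnNge.
have BA : B \subset A.
  by apply/bigcupsP => p _; apply/subsetP => a; rewrite inE => /andP[].
(* The small primes cancel; [B] and its complement in [A] are bounded separately, the latter
   strictly. *)
rewrite -(cardsID B A) (setIidPr BA) addnC -[X in (_ < X)%N]addnA ltn_add2l.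
by rewrite -addnS leq_add.
Qed.

Theorem theorem4 (d N : nat) (hd : (2 <= d)%N) (hN : (0 < N)%N) :
  (rho d N)%:Z <=
    \sum_(1 <= k < d) (primepi (N%:R / k%:R))%:Z
    + (davenport 'rV['Z_d]_(primepi (N%:R / d%:R)))%:Z
    - (d%:Z - 1) * (primepi (N%:R / d%:R))%:Z - 1.
Proof.
set m := primepi (N%:R / d%:R); set D := davenport _.
have -> : \sum_(1 <= k < d) (primepi (N%:R / k%:R))%:Z =
          (\sum_(1 <= k < d) primepi (N%:R / k%:R))%N%:Z.
  by rewrite -natz natr_sum; apply: eq_bigr => k _; rewrite natz.
set S := (\sum_(1 <= k < d) _)%N.
(* The strict inequality over the naturals supplies the final -1 over the integers. *)
have intE (a s e : nat) : (a + d.-1 * m < s + e)%N ->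
    a%:Z <= s%:Z + e%:Z - (d%:Z - 1) * m%:Z - 1.
  by case: (d) hd => // d' _ /=; nia.
apply: intE.
have lower A := card_power_product_free d N A hd.
(* A maximum is bounded termwise only by a non-strict inequality, so the strict bound is passed to
   the predecessor of [S + D - d.-1 * m]. The empty set, which is trivially free, shows that this
   truncated difference is positive. *)
have free0 :
    power_product_free d (mem [seq val i | i in (set0 : {set 'I_N.+1})]).
  move=> [[|a s] [x [//= _ _ /(_ a (mem_head _ _))]]].
  by move=> /imageP[i]; rewrite inE.
have S_gt : (d.-1 * m < S + D)%N.
  by have := lower set0 (negbT (in_set0 _)) free0; rewrite cards0.
rewrite addnC -ltn_subRL; rewrite -subn_gt0 in S_gt.
rewrite -(ltn_predK S_gt) ltnS.
apply/bigmax_leqP => A /andP[A0 /asboolP /(lower _ A0)].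
by rewrite addnC -ltn_subRL => ltA; rewrite -ltnS (ltn_predK ltA).
Qed.
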